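(* Let $A$ and $B$ be isoclinic skew braces, with isoclinism $(\xi,\theta)$. Let $H$ be a subgroup of $\overline{A_+}\rtimes_{\overline{\rho}}\overline{A_\circ}$ and let $K$ be the corresponding subgroup of $\overline{B_+}\rtimes_{\overline{\rho}}\overline{B_\circ}$, i.e. the image of $H$ under the isomorphism $(\overline{a},\overline{b})\mapsto(\xi(\overline{a}),\xi(\overline{b}))$ induced by the isoclinism. For $c\in\mathbb{Z}_{\geq 1}$, let $m_1$ be the number of $H$-orbits of size $c$ (on $A$) and $m_2$ the number of $K$-orbits of size $c$ (on $B$). Then \[ m_1=m_2|A|/|B|. \]
   Context: A skew brace is a triple $(A,+,\circ)$ where $(A,+)$ and $(A,\circ)$ are groups (neither assumed commutative) with $a\circ(b+c)=a\circ b-a+a\circ c$ for all $a,b,c\in A$; write $A_+=(A,+)$, $A_\circ=(A,\circ)$. The two groups share the identity $0$. Put $\lambda_a(b)=-a+a\circ b$, $a*b=-a+a\circ b-b$, $[a,b]_+=a+b-a-b$. The annihilator is $\operatorname{Ann}(A)=\ker\lambda\cap Z(A,+)\cap Z(A,\circ)$, an ideal of $A$, so that $A/\operatorname{Ann}(A)$ is a skew brace; $\overline{a}$ denotes the class of $a$. The commutator $A'$ of $A$ is the additive subgroup generated by all $[a,b]_+$ and all $a*b$, $a,b\in A$; it is an ideal of $A$ (in particular a sub skew brace). The values $[a,b]_+$ and $a*b$ depend only on the classes of $a,b$ modulo $\operatorname{Ann}(A)$. Skew braces $A$ and $B$ are isoclinic if there is an isoclinism $(\xi,\theta)$, i.e.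 skew brace isomorphisms $\xi\colon A/\operatorname{Ann}(A)\to B/\operatorname{Ann}(B)$ and $\theta\colon A'\to B'$ such that, whenever $a_1,a_2\in A$ and $b_1,b_2\in B$ satisfy $\xi(\overline{a_i})=\overline{b_i}$ for $i=1,2$, one has $\theta([a_1,a_2]_+)=[b_1,b_2]_+$ and $\theta(a_1*a_2)=b_1*b_2$. The map $\rho\colon A_\circ\to\operatorname{Aut}(A_+)$, $\rho_a(b)=a\circ b-a$, is a group homomorphism, and it induces $\overline{\rho}\colon\overline{A_\circ}\to\operatorname{Aut}(\overline{A_+})$, where $\overline{A_+}=A_+/\operatorname{Ann}(A)$ and $\overline{A_\circ}=A_\circ/\operatorname{Ann}(A)$. The semidirect product $\overline{A_+}\rtimes_{\overline{\rho}}\overline{A_\circ}$ has product $(\overline{a},\overline{b})(\overline{c},\overline{d})=(\overline{a}+\overline{\rho}_{\overline{b}}(\overline{c}),\overline{b}\circ\overline{d})$. It acts (in a well-defined way) on $A_+$ by automorphisms via $(\overline{a},\overline{b})\cdot x=a+\rho_b(x)-a$ for $x\in A$. For a subgroup $H$ of it, an $H$-orbit is the orbit of an element of $A$ under the restriction of this action to $H$. The same notation is used for $B$. *)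

(* Defs.v *)
From HB Require Import structures.
From mathcomp Require Import all_boot all_order all_algebra all_fingroup all_solvable.

Set Implicit Arguments.
Unset Strict Implicit.
Unset Printing Implicit Defensive.

(* A MathComp group is written multiplicatively; the additive group (A, +) of *)
(* a skew brace (not assumed commutative) is its underlying finGroupType, and *)
(* the notations below restore the additive notation.                         *)
Declare Scope brace_scope.
Delimit Scope brace_scope with SB.
Notation "x + y" := (mulg x y) (only parsing) : brace_scope.
Notation "- x" := (invg x) (only parsing) : brace_scope.
Notation "x - y" := (mulg x (invg y)) (only parsing) : brace_scope.

Local Open Scope group_scope.

HB.mixin Record isSkewBrace A of FinGroup A := {
  circ : A -> A -> A;
  cinv : A -> A;
  circA : associative circ;
  circ0b : left_id (1 : A) circ;
  cinvb : left_inverse (1 : A) cinv circ;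
  circDr : forall a b c : A,
    circ a (b + c)%SB = (circ a b - a + circ a c)%SB
}.

#[short(type="finSkewBraceType")]
HB.structure Definition FinSkewBrace := {A of isSkewBrace A & FinGroup A}.

Notation "x \circ y" := (circ x y) (at level 40, left associativity).

Section Operations.
Variable A : finSkewBraceType.
Implicit Types a b : A.

Definition lam a b : A := (- a + a \circ b)%SB.
Definition rho a b : A := (a \circ b - a)%SB.
Definition star a b : A := (- a + a \circ b - b)%SB.
(* Not MathComp's [~ a, b], which is - a - b + a + b. *)
Definition addcomm a b : A := (a + b - a - b)%SB.

Definition ker_lam : {set A} := [set a | [forall b, lam a b == b]].
Definition circ_center : {set A} := [set a | [forall b, a \circ b == b \circ a]].
Definition Ann : {set A} := ker_lam :&: 'Z([set: A]) :&: circ_center.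

End Operations.

Section BraceTheory.
Variable A : finSkewBraceType.
Implicit Types a b c z w : A.

Lemma circKb a : cancel (circ a) (circ (cinv a)).
Proof. by move=> b; rewrite circA cinvb circ0b. Qed.

Lemma circI a : injective (circ a).
Proof. exact: can_inj (circKb a). Qed.

Lemma circb0 a : a \circ 1 = a.
Proof. by apply: (@circI (cinv a)); rewrite circA cinvb circ0b. Qed.

Lemma circbV a : a \circ cinv a = 1.
Proof. by apply: (@circI (cinv a)); rewrite circA cinvb circ0b circb0. Qed.

Lemma circN a b : a \circ b^-1 = a * (a \circ b)^-1 * a.
Proof.
have := circDr a b b^-1; rewrite mulgV circb0 => /(congr1 (mulg (a \circ b)^-1)).
by rewrite !mulgA mulVg mul1g => /(congr1 (mulg a)); rewrite !mulgA mulgV mul1g.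
Qed.

Lemma circ_lam a b : a \circ b = a * lam a b.
Proof. by rewrite /lam mulKVg. Qed.

Lemma circ_star a b : a \circ b = a * star a b * b.
Proof. by rewrite /star !mulgA mulgKV mulgV mul1g. Qed.

Lemma rho_morph a b c : rho a (b * c) = rho a b * rho a c.
Proof. by rewrite /rho circDr !mulgA. Qed.

Lemma rhoV a b : rho a b^-1 = (rho a b)^-1.
Proof.
apply/esym/eqP; rewrite eq_invg_mul -rho_morph mulgV.
by rewrite /rho circb0 mulgV.
Qed.

Lemma rho0 b : rho 1 b = b.
Proof. by rewrite /rho circ0b invg1 mulg1. Qed.

Lemma rho_circ a b c : rho (a \circ b) c = rho a (rho b c).
Proof. by rewrite /rho circDr circN -circA !mulgA mulgK mulgKV. Qed.

Lemma AnnP z : reflect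
  [/\ forall b, lam z b = b, forall b, z * b = b * z
     & forall b, z \circ b = b \circ z] (z \in Ann A).
Proof.
rewrite !inE; apply: (iffP idP) => [/andP[/andP[/forallP l /centP c] /forallP o]|[l c o]].
  split=> b; [exact/eqP/l | exact/c/in_setT | exact/eqP/o].
rewrite -andbA; apply/and3P; split.
- by apply/forallP=> b; apply/eqP.
- by apply/centP=> b _; exact: c.
- by apply/forallP=> b; apply/eqP.
Qed.

Lemma Ann_circl z b : z \in Ann A -> z \circ b = z * b.
Proof. by case/AnnP=> l _ _; rewrite circ_lam l. Qed.

Lemma Ann_circr z b : z \in Ann A -> b \circ z = b * z.
Proof. by move=> zA; case/AnnP: (zA) => _ c o; rewrite -o Ann_circl // c. Qed.

Lemma Ann_group_set : group_set (Ann A).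
Proof.
apply/group_setP; split=> [|z w zA wA].
  by apply/AnnP; split=> b; rewrite ?circ0b ?circb0 ?mul1g ?mulg1 // /lam circ0b invg1 mul1g.
case/AnnP: (zA) => zl zc zo; case/AnnP: (wA) => wl wc wo.
have lzw b : lam (z * w) b = b.
  by rewrite /lam -(Ann_circl w zA) -circA !Ann_circl // (mulgA z) mulKg.
apply/AnnP; split=> // b; first by rewrite -mulgA wc mulgA zc mulgA.
by rewrite -(Ann_circl w zA) -circA wo circA zo -circA.
Qed.

Canonical Ann_group := Group Ann_group_set.

Lemma Ann_norm a : a \in 'N(Ann A).
Proof.
apply: (subsetP (cent_sub _)); apply/centP=> z /AnnP[_ c _].
by rewrite /commute c.
Qed.

End BraceTheory.

Definition quot_ann (A : finSkewBraceType) := coset_of (Ann A).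
HB.instance Definition _ (A : finSkewBraceType) :=
  FinGroup.copy (quot_ann A) (coset_of (Ann A)).

Definition cls (A : finSkewBraceType) (a : A) : quot_ann A := coset (Ann A) a.
Definition rep (A : finSkewBraceType) (x : quot_ann A) : A := repr x.

Section Quotient.
Variable A : finSkewBraceType.
Implicit Types (a b : A) (x y : quot_ann A).

Definition quot_circ x y : quot_ann A := cls (rep x \circ rep y).
Definition quot_cinv x : quot_ann A := cls (cinv (rep x)).

Lemma cls_rep x : cls (rep x) = x.
Proof. exact: coset_reprK. Qed.

Lemma clsM a b : cls (a * b) = cls a * cls b.
Proof. by rewrite /cls morphM ?Ann_norm. Qed.

Lemma clsV a : cls a^-1 = (cls a)^-1.
Proof. by rewrite /cls morphV ?Ann_norm. Qed.

Lemma cls1 : cls (1 : A) = 1.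
Proof. exact: morph1. Qed.

Lemma clsP a b : cls a = cls b -> exists2 z, z \in Ann A & a = b * z.
Proof.
move=> eq_ab; exists (b^-1 * a); last by rewrite mulKVg.
by apply: coset_idr; rewrite ?Ann_norm // -[coset _ _]/(cls _) clsM clsV eq_ab mulVg.
Qed.

Lemma cls_Ann a z : z \in Ann A -> cls (a * z) = cls a.
Proof. by move=> zA; rewrite clsM [cls z]coset_id // mulg1. Qed.

Lemma quot_circE a b : quot_circ (cls a) (cls b) = cls (a \circ b).
Proof.
rewrite /quot_circ; have [z zA ->] := clsP (cls_rep (cls a)).
have [w wA ->] := clsP (cls_rep (cls b)).
rewrite -(Ann_circr b wA) circA [_ \circ w]Ann_circr // cls_Ann //.
rewrite -(Ann_circr a zA) -circA [z \circ b]Ann_circl //.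
case/AnnP: (zA) => _ -> _.
by rewrite -(Ann_circr b zA) circA [_ \circ z]Ann_circr // cls_Ann.
Qed.

Lemma quot_circA : associative quot_circ.
Proof.
move=> x y z; rewrite -[x]cls_rep -[y]cls_rep -[z]cls_rep.
by rewrite !quot_circE circA.
Qed.

Lemma quot_circ0b : left_id (1 : quot_ann A) quot_circ.
Proof. by move=> x; rewrite -[x]cls_rep -cls1 quot_circE circ0b. Qed.

Lemma quot_cinvb : left_inverse (1 : quot_ann A) quot_cinv quot_circ.
Proof.
by move=> x; rewrite -[x in quot_circ _ x]cls_rep quot_circE cinvb cls1.
Qed.

Lemma quot_circDr x y z :
  quot_circ x (y * z) = quot_circ x y * x^-1 * quot_circ x z.
Proof.
rewrite -[x]cls_rep -[y]cls_rep -[z]cls_rep -clsM !quot_circE circDr.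
by rewrite !clsM clsV.
Qed.

HB.instance Definition _ := isSkewBrace.Build (quot_ann A)
  quot_circA quot_circ0b quot_cinvb quot_circDr.

Lemma cls_circ a b : cls (a \circ b) = cls a \circ cls b.
Proof. exact/esym/quot_circE. Qed.

Lemma cls_rho a b : cls (rho a b) = rho (cls a) (cls b).
Proof. by rewrite /rho -cls_circ -clsV -clsM. Qed.

End Quotient.

Section Commutator.
Variable A : finSkewBraceType.

Definition commutator : {set A} :=
  <<[set addcomm p.1 p.2 | p : A * A] :|: [set star p.1 p.2 | p : A * A]>>.
Canonical commutator_group := [group of commutator].

Lemma mem_addcomm (a b : A) : addcomm a b \in commutator.
Proof. by apply/mem_gen/setUP; left; apply/imsetP; exists (a, b); rewrite ?inE. Qed.

Lemma mem_star (a b : A) : star a b \in commutator.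
Proof. by apply/mem_gen/setUP; right; apply/imsetP; exists (a, b); rewrite ?inE. Qed.

Lemma commutator_circ (a b : A) :
  a \in commutator -> b \in commutator -> a \circ b \in commutator.
Proof.
move=> aC bC; rewrite circ_star; apply: (groupM _ bC).
exact: (groupM aC (mem_star _ _)).
Qed.

Lemma commutator_cinv (a : A) : a \in commutator -> cinv a \in commutator.
Proof.
move=> aC; have := circbV a; rewrite circ_star.
move/(congr1 (mulg (a * star a (cinv a))^-1)); rewrite mulKg mulg1 => ->.
by rewrite groupV; exact: (groupM aC (mem_star _ _)).
Qed.

End Commutator.

Definition comm_brace (A : finSkewBraceType) := subg_of (commutator_group A).
HB.instance Definition _ (A : finSkewBraceType) :=
  FinGroup.copy (comm_brace A) (subg_of (commutator_group A)).

Section CommutatorBrace.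
Variable A : finSkewBraceType.
Implicit Types u v w : comm_brace A.

Definition comm_circ u v : comm_brace A :=
  Subg (commutator_circ (subgP u) (subgP v)).
Definition comm_cinv u : comm_brace A := Subg (commutator_cinv (subgP u)).

Lemma comm_circA : associative comm_circ.
Proof. by move=> u v w; apply: val_inj; exact: circA. Qed.

Lemma comm_circ0b : left_id (1 : comm_brace A) comm_circ.
Proof. by move=> u; apply: val_inj; exact: circ0b. Qed.

Lemma comm_cinvb : left_inverse (1 : comm_brace A) comm_cinv comm_circ.
Proof. by move=> u; apply: val_inj; exact: cinvb. Qed.

Lemma comm_circDr u v w :
  comm_circ u (v * w) = comm_circ u v * u^-1 * comm_circ u w.
Proof. by apply: val_inj; exact: circDr. Qed.

HB.instance Definition _ := isSkewBrace.Build (comm_brace A)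
  comm_circA comm_circ0b comm_cinvb comm_circDr.

Definition addcomm' (a b : A) : comm_brace A := Subg (mem_addcomm a b).
Definition star' (a b : A) : comm_brace A := Subg (mem_star a b).

End CommutatorBrace.

Definition brace_iso (X Y : finSkewBraceType) (f : X -> Y) : Prop :=
  [/\ bijective f,
      {morph f : x y / (x + y)%SB >-> (x + y)%SB}
    & {morph f : x y / x \circ y >-> x \circ y}].

Definition isoclinism (A B : finSkewBraceType)
    (xi : quot_ann A -> quot_ann B) (theta : comm_brace A -> comm_brace B) : Prop :=
  [/\ brace_iso xi, brace_iso theta
    & forall (a1 a2 : A) (b1 b2 : B),
        xi (cls a1) = cls b1 -> xi (cls a2) = cls b2 ->
        theta (addcomm' a1 a2) = addcomm' b1 b2 /\
        theta (star' a1 a2) = star' b1 b2].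

(* The pairs of the semidirect product of X_+ by X_o along rho. A record and  *)
(* not X * X, which carries the direct product structure; MathComp's          *)
(* sdprod_by is not used since it is built from right actions.                *)
Record sdp (X : finSkewBraceType) := SdpPair { sdp_add : X; sdp_circ : X }.

Definition pair_of_sdp X (g : sdp X) : X * X := (sdp_add g, sdp_circ g).
Definition sdp_of_pair (X : finSkewBraceType) (p : X * X) := SdpPair p.1 p.2.
Lemma pair_of_sdpK X : cancel (@pair_of_sdp X) (@sdp_of_pair X).
Proof. by case. Qed.
HB.instance Definition _ (X : finSkewBraceType) :=
  Finite.copy (sdp X) (can_type (@pair_of_sdpK X)).

Section SemiDirect.
Variable X : finSkewBraceType.
Implicit Types g h k : sdp X.

Definition sdp_one : sdp X := SdpPair 1 1.
Definition sdp_mul g h : sdp X :=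
  SdpPair (sdp_add g + rho (sdp_circ g) (sdp_add h))%SB
          (sdp_circ g \circ sdp_circ h).
Definition sdp_inv g : sdp X :=
  SdpPair (rho (cinv (sdp_circ g)) (sdp_add g)^-1) (cinv (sdp_circ g)).

Lemma sdp_mulA : associative sdp_mul.
Proof.
by move=> g h k; rewrite /sdp_mul /= rho_morph rho_circ circA !mulgA.
Qed.

Lemma sdp_mul1 : left_id sdp_one sdp_mul.
Proof. by case=> a b; rewrite /sdp_mul /= rho0 mul1g circ0b. Qed.

Lemma sdp_mulV : left_inverse sdp_one sdp_inv sdp_mul.
Proof.
case=> a b; rewrite /sdp_mul /sdp_inv /= cinvb -rho_morph mulVg.
by rewrite /rho circb0 mulgV.
Qed.

HB.instance Definition _ :=
  Finite_isGroup.Build (sdp X) sdp_mulA sdp_mul1 sdp_mulV.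

End SemiDirect.

Section Action.
Variable A : finSkewBraceType.
Implicit Types (g : sdp (quot_ann A)) (a b x : A).

Definition sdact g x : A :=
  (rep (sdp_add g) + rho (rep (sdp_circ g)) x - rep (sdp_add g))%SB.

Lemma sdactE a b x : sdact (SdpPair (cls a) (cls b)) x = (a + rho b x - a)%SB.
Proof.
rewrite /sdact /=; have [z zA ->] := clsP (cls_rep (cls a)).
have [w wA ->] := clsP (cls_rep (cls b)).
have -> : rho (b * w) x = rho b x.
  rewrite -(Ann_circr b wA) rho_circ; congr (rho b _).
  by rewrite /rho Ann_circl //; case/AnnP: wA => _ -> _; rewrite mulgK.
move: (rho b x) => y; rewrite invMg -!mulgA; congr (_ * _); rewrite !mulgA.
by case/AnnP: zA => _ -> _; rewrite mulgK.
Qed.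

Lemma sdact1 x : sdact 1 x = x.
Proof.
by rewrite -[1]/(SdpPair 1 1) -cls1 sdactE rho0 invg1 mulg1 mul1g.
Qed.

Lemma sdactM g h x : sdact (g * h) x = sdact g (sdact h x).
Proof.
case: g h => [u v] [s t].
rewrite -[u]cls_rep -[v]cls_rep -[s]cls_rep -[t]cls_rep.
move: (rep u) (rep v) (rep s) (rep t) => a b c d.
rewrite [_ * _]/(sdp_mul _ _) /sdp_mul /= -cls_rho -cls_circ -clsM.
rewrite 3!sdactE rho_circ (rho_morph b (c * rho d x)) (rho_morph b c) rhoV.
by move: (rho b c) (rho b (rho d x)) => y z; rewrite invMg !mulgA.
Qed.

Lemma sdact_morph g : {morph sdact g : x y / x * y}.
Proof. by move=> x y; rewrite /sdact rho_morph !mulgA mulgKV. Qed.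

Definition sdorbit (H : {set sdp (quot_ann A)}) x : {set A} :=
  [set sdact h x | h in H].

Definition num_orbits (H : {set sdp (quot_ann A)}) (c : nat) : nat :=
  #|[set O in [set sdorbit H x | x : A] | #|O| == c]|.

End Action.

Definition sdp_map (X Y : finSkewBraceType) (f : X -> Y) (g : sdp X) : sdp Y :=
  SdpPair (f (sdp_add g)) (f (sdp_circ g)).

(* Main.v *)
(* For h = (a, b) the displacement h.x - x is the word [a+b, b*x]_+ + b*x +   *)
(* [a+b, x]_+ in A', so theta sends it to the corresponding displacement in B *)
(* of any y whose class is the image under xi of the class of x. Hence the    *)
(* H-orbit of x and the K-orbit of y have the same size, this size depends    *)
(* only on classes modulo the annihilators, and summing it over A and B gives *)
(* c m_1 = |Ann A| N and c m_2 = |Ann B| N for a common N, whereas            *)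
(* |A|/|Ann A| = |B|/|Ann B|.                                                 *)
Require Import Defs.
From mathcomp Require Import all_boot all_order all_algebra all_fingroup all_solvable.

Set Implicit Arguments.
Unset Strict Implicit.
Unset Printing Implicit Defensive.

Import GRing.Theory Num.Theory.

Local Open Scope group_scope.

(** Acting by [h] moves [x] by an element of the commutator that is a word in values of [addcomm]
    and [star] ([displacementE]), exactly what an isoclinism transports. So points with
    corresponding classes have orbits of equal size ([isoclinism_card_sdorbit]). Counting the points
    in orbits of size [c] by orbits ([card_sdorbit_eq]) and by classes ([card_cls_preim]) gives the
    ratio of annihilator orders, which is |A|/|B| since the quotients are isomorphic. *)

Lemma cls_star (A : finSkewBraceType) (a b : A) :
  cls (star a b) = star (cls a) (cls b).
Proof. by rewrite /star !clsM !clsV cls_circ. Qed.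

Section Orbits.
Variable A : finSkewBraceType.
Implicit Types (H : {group sdp (quot_ann A)}) (h : sdp (quot_ann A)) (a b x y : A).

Lemma sdorbit_refl H x : x \in sdorbit H x.
Proof. by apply/imsetP; exists 1; rewrite ?sdact1. Qed.

Lemma sdorbit_eqP H x y : y \in sdorbit H x -> sdorbit H y = sdorbit H x.
Proof.
case/imsetP=> h hH ->; apply/setP=> z; apply/imsetP/imsetP=> -[k kH ->].
  by exists (k * h); rewrite ?groupM // sdactM.
by exists (k * h^-1); rewrite ?groupM ?groupV // -sdactM mulgKV.
Qed.

Lemma card_sdorbit_eq H c :
  #|[set x | #|sdorbit H x| == c]| = (num_orbits H c * c)%N.
Proof.
apply: card_uniform_partition => [O|]; first by rewrite inE => /andP[_ /eqP].
apply/and3P; split.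
- apply/eqP/setP=> x; apply/bigcupP/idP=> [[O]|].
    rewrite !inE => /andP[/imsetP[y _ ->] Oc] Ox.
    by rewrite (sdorbit_eqP Ox).
  rewrite inE => xc; exists (sdorbit H x); last exact: sdorbit_refl.
  by rewrite inE xc imset_f.
- apply/trivIsetP=> _ _ /setIdP[/imsetP[x _ ->] _] /setIdP[/imsetP[y _ ->] _].
  apply: contraR => /pred0Pn[z /andP[/= zx zy]].
  by rewrite -(sdorbit_eqP zx) (sdorbit_eqP zy).
- apply/negP=> /setIdP[/imsetP[x _ O0] _].
  by have := sdorbit_refl H x; rewrite -O0 inE.
Qed.

(** Typed in [comm_brace A] so that [theta] applies to it. *)
Definition displacement h x : comm_brace A :=
  let b := rep (sdp_circ h) in let d := rep (sdp_add h) * b in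
  addcomm' d (star b x) * star' b x * addcomm' d x.

Lemma displacementE h x : val (displacement h x) * x = sdact h x.
Proof.
rewrite /= /addcomm /sdact /star /rho.
by rewrite !(mulgA, invMg, invgK, mulgKV, mulgK).
Qed.

(** Right translation by [x] is injective and carries the displacements onto the orbit. *)
Lemma card_displacements H x :
  #|[set displacement h x | h in H]| = #|sdorbit H x|.
Proof.
have inj_x : injective (fun u : comm_brace A => val u * x).
  by move=> u v /mulIg /val_inj.
rewrite -(card_imset _ inj_x) -imset_comp; congr #|pred_of_set _|.
by apply: eq_imset => h; exact: displacementE.
Qed.

(** Each fibre of [cls] is a coset of [Ann A]. *)
Lemma card_cls_preim (P : pred (quot_ann A)) :
  #|[set x : A | P (cls x)]| = (#|[set u | P u]| * #|Ann A|)%N.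
Proof.
rewrite -sum1_card (partition_big (@cls A) (mem [set u | P u])) /=; last first.
  by move=> x; rewrite !inE.
rewrite -sum_nat_const; apply: eq_bigr => u; rewrite inE => Pu.
rewrite sum1dep_card -(card_lcoset (Ann A) (rep u)); apply: eq_card => x.
rewrite !inE mem_lcoset; apply/andP/idP=> [[_ /eqP ux]|xA].
  have [z zA ->] := clsP (etrans ux (esym (cls_rep u))).
  by rewrite mulKg.
suff ux : cls x = u by rewrite ux Pu eqxx.
by rewrite -[x](mulKVg (rep u)) cls_Ann // cls_rep.
Qed.

Lemma card_quot_ann : #|A| = (#|{: quot_ann A}| * #|Ann A|)%N.
Proof. by have := card_cls_preim predT; rewrite !cardsE. Qed.

End Orbits.

Section Isoclinism.
Variables A B : finSkewBraceType.
Variables (xi : quot_ann A -> quot_ann B) (theta : comm_brace A -> comm_brace B).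
Hypothesis isoAB : isoclinism xi theta.

Lemma brace_isoV (X Y : finSkewBraceType) (f : X -> Y) :
  brace_iso f -> {morph f : x / x^-1}.
Proof.
case=> _ fM _ x; have f1 : f 1 = 1.
  by apply: (mulgI (f 1)); rewrite -fM !mulg1.
by apply/eqP; rewrite eq_sym eq_invg_mul -fM mulgV f1.
Qed.

(** The arguments of every factor, including the inner [star b x], have classes matched by [xi], so
    the isoclinism condition applies factor by factor. *)
Lemma isoclinism_displacement h (x : A) (y : B) :
  xi (cls x) = cls y ->
  theta (displacement h x) = displacement (sdp_map xi h) y.
Proof.
case: isoAB => isoxi [_ thetaM _] theta_comm xy.
have [_ xiM xio] := isoxi; have xiV := brace_isoV isoxi.
rewrite /displacement /=; set a := rep _; set b := rep (sdp_circ h).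
set a' := rep (xi (sdp_add h)); set b' := rep (xi (sdp_circ h)).
have bb : xi (cls b) = cls b' by rewrite !cls_rep.
have dd : xi (cls (a * b)) = cls (a' * b') by rewrite !clsM xiM !cls_rep.
have ss : xi (cls (star b x)) = cls (star b' y).
  by rewrite !cls_star {1}/star !xiM !xiV xio bb xy.
rewrite !thetaM (theta_comm _ _ _ _ dd ss).1 (theta_comm _ _ _ _ dd xy).1.
by rewrite (theta_comm _ _ _ _ bb xy).2.
Qed.

Lemma isoclinism_card_sdorbit (H : {group sdp (quot_ann A)})
    (K : {group sdp (quot_ann B)}) (x : A) (y : B) :
  K :=: [set sdp_map xi h | h in H] -> xi (cls x) = cls y ->
  #|sdorbit H x| = #|sdorbit K y|.
Proof.
move=> defK xy; rewrite -!card_displacements defK -imset_comp.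
have [_ [/bij_inj theta_inj _ _] _] := isoAB.
rewrite -(card_imset _ theta_inj) -imset_comp; congr #|pred_of_set _|.
by apply: eq_imset => h; exact: isoclinism_displacement.
Qed.

End Isoclinism.

Theorem theorem3p19 (A B : finSkewBraceType)
    (xi : quot_ann A -> quot_ann B) (theta : comm_brace A -> comm_brace B)
    (isoAB : isoclinism xi theta)
    (H : {group sdp (quot_ann A)}) (K : {group sdp (quot_ann B)})
    (defK : K :=: [set sdp_map xi h | h in H])
    (c m1 m2 : nat) (c_gt0 : (0 < c)%N)
    (def_m1 : m1 = num_orbits H c) (def_m2 : m2 = num_orbits K c) :
  (m1%:R = m2%:R * #|A|%:R / #|B|%:R :> rat)%R.
Proof.
have [[xi_bij _ _] _ _] := isoAB.
have orbE := isoclinism_card_sdorbit isoAB defK.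
have [xi' _ xi'K] := xi_bij.
pose P v := #|sdorbit K (rep v)| == c.
have PA : [set x | #|sdorbit H x| == c] = [set x | P (xi (cls x))].
  by apply/setP=> x; rewrite !inE /P (orbE x (rep (xi (cls x)))) // cls_rep.
have PB : [set y | #|sdorbit K y| == c] = [set y | P (cls y)].
  (* Two points of [B] in one class are compared through a common point [x] of [A]. *)
  apply/setP=> y; rewrite !inE /P; pose x := rep (xi' (cls y)).
  have xE : xi (cls x) = cls y by rewrite cls_rep xi'K.
  by rewrite -(orbE x y xE) (orbE x (rep (cls y))) // cls_rep.
have := card_sdorbit_eq H c; have := card_sdorbit_eq K c.
rewrite PA PB (card_cls_preim (fun u => P (xi u))) card_cls_preim.
have -> : #|[set u | P (xi u)]| = #|[set v | P v]|.
  rewrite -(on_card_preimset (R := [set v | P v]) (f := xi)).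
    by apply: eq_card => u; rewrite !inE.
  exact: onW_bij.
rewrite -def_m1 -def_m2 => EB EA.
have cardAB : #|{: quot_ann A}| = #|{: quot_ann B}| := bij_eq_card xi_bij.
have eqm : (m1 * #|B| = m2 * #|A|)%N.
  (* After scaling by [c], both sides equal the number of classes satisfying [P] times the orders of
     both annihilators and of the common quotient. *)
  apply/eqP; rewrite -(eqn_pmul2r c_gt0) mulnAC -EA [in eqbRHS]mulnAC -EB.
  by rewrite (card_quot_ann A) (card_quot_ann B) cardAB mulnACA
    [in eqbRHS]mulnACA [(#|Ann A| * _)%N]mulnC.
have B_neq0 : (#|B|%:R != 0 :> rat)%R.
  by rewrite pnatr_eq0 -lt0n; apply/card_gt0P; exists 1.
by apply: (mulIf B_neq0); rewrite mulfVK // -!natrM eqm.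
Qed.
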